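(* Let $(\mathcal C,\otimes,I)$ be a symmetric monoidal category with finite coproducts and a terminal object $1$, and let $\mathsf T=(T,\eta,\mu)$ be a linear exponential monad on $(\mathcal C,\otimes,I)$ which is affine, i.e. the unique map $T1\to1$ is invertible. Then for every finite family of objects $(A_i)_i$ of $\mathcal C$, the hypernormalisation map $\mathcal N\colon T(\sum_i A_i)\to T(\sum_i TA_i)$ satisfies $$T(\textstyle\sum_i !_{TA_i})\circ\mathcal N=T(\sum_i !_{A_i})\colon T(\sum_i A_i)\to T(\sum_i 1),$$ where $!_X\colon X\to1$ denotes the unique map to the terminal object.
   Context: A symmetric opmonoidal structure on a monad $\mathsf T=(T,\eta,\mu)$ on a symmetric monoidal category $(\mathcal C,\otimes,I)$ consists of a map $\upsilon_I\colon TI\to I$ and natural maps $\upsilon_{XY}\colon T(X\otimes Y)\to TX\otimes TY$ making $T$ a symmetric opmonoidal (colax monoidal) functor and $\eta,\mu$ opmonoidal transformations. It lifts the symmetric monoidal structure of $\mathcal C$ to the category $\mathcal C^{\mathsf T}$ of Eilenberg--Moore algebras: $(X,x)\otimes(Y,y)=(X\otimes Y,(x\otimes y)\circ\upsilon_{XY})$, with unit $(I,\upsilon_I)$ and constraints those of $\mathcal C$. A linear exponential monad is a symmetric opmonoidal monad for which the lifted structure on $\mathcal C^{\mathsf T}$ is given by finite coproducts: $(I,\upsilon_I)$ is initial in $\mathcal C^{\mathsf T}$, and for all algebras $(X,x),(Y,y)$ the cospan $(X,x)\cong(X,x)\otimes(I,\upsilon_I)\xrightarrow{1\otimes !}(X,x)\otimes(Y,y)\xleftarrow{!\otimes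 1}(I,\upsilon_I)\otimes(Y,y)\cong(Y,y)$ is a coproduct in $\mathcal C^{\mathsf T}$, where $!$ denotes here the unique maps out of the initial algebra. Given finite coproducts in $\mathcal C$, write $\varphi\colon T(\sum_i A_i)\to\bigotimes_i TA_i$ for the map underlying the canonical $\mathsf T$-algebra isomorphism $F^{\mathsf T}(\sum_i A_i)\cong\bigotimes_i F^{\mathsf T}A_i$ between two coproducts of the free algebras $F^{\mathsf T}A_i=(TA_i,\mu_{A_i})$. The $n$-ary hypernormalisation map is the composite in $\mathcal C$ $$\mathcal N\colon T(\textstyle\sum_i A_i)\xrightarrow{\varphi}\bigotimes_i TA_i\xrightarrow{\bigotimes_i\eta_{TA_i}}\bigotimes_i TTA_i\xrightarrow{\varphi^{-1}}T(\sum_i TA_i).$$ *)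

(* Defs.v *)
(* Hom-sets carry Leibniz equality.  The only axiom used is proof irrelevance, so
   that an algebra morphism is determined by its underlying map. *)
From Stdlib Require Import ProofIrrelevance.
From Stdlib Require Fin.

Set Implicit Arguments.
Unset Strict Implicit.
Unset Printing Implicit Defensive.

Declare Scope cat_scope.
Open Scope cat_scope.

Reserved Notation "g ∘ f" (at level 40, left associativity).
Reserved Notation "X ⊗ Y" (at level 35, right associativity).
Reserved Notation "f ⊠ g" (at level 35, right associativity).

Record category := Category {
  obj :> Type;
  hom : obj -> obj -> Type;
  idm : forall X, hom X X;
  comp : forall X Y Z, hom Y Z -> hom X Y -> hom X Z;
  comp_idl : forall X Y (f : hom X Y), comp (idm Y) f = f;
  comp_idr : forall X Y (f : hom X Y), comp f (idm X) = f;
  comp_assoc : forall W X Y Z (h : hom Y Z) (g : hom X Y) (f : hom W X),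
    comp h (comp g f) = comp (comp h g) f }.

Arguments hom {_} _ _.
Arguments idm {_} _.
Arguments comp {_ _ _ _} _ _.
Notation "g ∘ f" := (comp g f) : cat_scope.

Record iso (C : category) (X Y : C) := Iso {
  iso_fwd :> hom X Y;
  iso_bwd : hom Y X;
  iso_fwdK : iso_bwd ∘ iso_fwd = idm X;
  iso_bwdK : iso_fwd ∘ iso_bwd = idm Y }.

Definition is_invertible (C : category) (X Y : C) (f : hom X Y) : Prop :=
  exists g : hom Y X, g ∘ f = idm X /\ f ∘ g = idm Y.

Record functor (C D : category) := Functor {
  fobj :> C -> D;
  fmap : forall X Y : C, hom X Y -> hom (fobj X) (fobj Y);
  fmap_id : forall X, fmap (idm X) = idm (fobj X);
  fmap_comp : forall X Y Z (g : hom Y Z) (f : hom X Y),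
    fmap (g ∘ f) = fmap g ∘ fmap f }.

Arguments fmap {_ _} _ {_ _} _.

Definition id_functor (C : category) : functor C C :=
  @Functor C C (fun X => X) (fun _ _ f => f)
    (fun _ => eq_refl) (fun _ _ _ _ _ => eq_refl).

Lemma comp_functor_id (B C D : category) (G : functor C D) (F : functor B C) X :
  fmap G (fmap F (idm X)) = idm (G (F X)).
Proof. now rewrite !fmap_id. Qed.

Lemma comp_functor_comp (B C D : category) (G : functor C D) (F : functor B C)
    X Y Z (g : hom Y Z) (f : hom X Y) :
  fmap G (fmap F (g ∘ f)) = fmap G (fmap F g) ∘ fmap G (fmap F f).
Proof. now rewrite !fmap_comp. Qed.

Definition comp_functor (B C D : category) (G : functor C D) (F : functor B C) :
    functor B D :=
  @Functor B D (fun X => G (F X)) (fun _ _ f => fmap G (fmap F f))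
    (comp_functor_id G F) (comp_functor_comp G F).

Record nat_trans (C D : category) (F G : functor C D) := NatTrans {
  nt_map :> forall X, hom (F X) (G X);
  nt_nat : forall X Y (f : hom X Y), nt_map Y ∘ fmap F f = fmap G f ∘ nt_map X }.

Record monad (C : category) := Monad {
  monad_functor :> functor C C;
  eta : nat_trans (id_functor C) monad_functor;
  mu : nat_trans (comp_functor monad_functor monad_functor) monad_functor;
  mu_eta : forall X, mu X ∘ eta (monad_functor X) = idm (monad_functor X);
  mu_fmap_eta : forall X, mu X ∘ fmap monad_functor (eta X) = idm (monad_functor X);
  mu_mu : forall X, mu X ∘ mu (monad_functor X) = mu X ∘ fmap monad_functor (mu X) }.

Arguments eta {_} _.
Arguments mu {_} _.

Record is_initial (C : category) (Z : C) := IsInitial {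
  init_map : forall X : C, hom Z X;
  init_uniq : forall (X : C) (f : hom Z X), f = init_map X }.

Record is_binary_coproduct (C : category) (X Y S : C) (l : hom X S) (r : hom Y S) :=
  IsBinaryCoproduct {
  bcopair : forall Z : C, hom X Z -> hom Y Z -> hom S Z;
  bcopair_l : forall (Z : C) (f : hom X Z) (g : hom Y Z), bcopair f g ∘ l = f;
  bcopair_r : forall (Z : C) (f : hom X Z) (g : hom Y Z), bcopair f g ∘ r = g;
  bcopair_uniq : forall (Z : C) (f : hom X Z) (g : hom Y Z) (h : hom S Z),
    h ∘ l = f -> h ∘ r = g -> h = bcopair f g }.

Record is_coproduct (C : category) (J : Type) (A : J -> C) (S : C)
    (inj : forall j, hom (A j) S) := IsCoproduct {
  copair : forall Z : C, (forall j, hom (A j) Z) -> hom S Z;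
  copair_inj : forall (Z : C) (f : forall j, hom (A j) Z) j, copair f ∘ inj j = f j;
  copair_uniq : forall (Z : C) (f : forall j, hom (A j) Z) (h : hom S Z),
    (forall j, h ∘ inj j = f j) -> h = copair f }.

Lemma coproduct_endo (C : category) (J : Type) (A : J -> C) (S : C)
    (inj : forall j, hom (A j) S) (P : is_coproduct inj) (h : hom S S) :
  (forall j, h ∘ inj j = inj j) -> h = idm S.
Proof.
  intros H. rewrite (copair_uniq P H). symmetry.
  apply copair_uniq. intros j. apply comp_idl.
Qed.

Lemma coproduct_iso_K (C : category) (J : Type) (A : J -> C) (S S' : C)
    (inj : forall j, hom (A j) S) (inj' : forall j, hom (A j) S')
    (P : is_coproduct inj) (P' : is_coproduct inj') :
  copair P' inj ∘ copair P inj' = idm S.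
Proof.
  apply (coproduct_endo P). intros j.
  now rewrite <- comp_assoc, !copair_inj.
Qed.

Definition coproduct_iso (C : category) (J : Type) (A : J -> C) (S S' : C)
    (inj : forall j, hom (A j) S) (inj' : forall j, hom (A j) S')
    (P : is_coproduct inj) (P' : is_coproduct inj') : iso S S' :=
  Iso (coproduct_iso_K P P') (coproduct_iso_K P' P).

Record terminal (C : category) := Terminal {
  term_obj :> C;
  bang : forall X : C, hom X term_obj;
  bang_uniq : forall (X : C) (f : hom X term_obj), f = bang X }.

Record finite_coproducts (C : category) := FiniteCoproducts {
  csum : forall n, (Fin.t n -> C) -> C;
  cinj : forall n (A : Fin.t n -> C) i, hom (A i) (csum A);
  csum_coproduct : forall n (A : Fin.t n -> C), is_coproduct (cinj A) }.

Arguments csum {_} _ {_} _.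
Arguments cinj {_} _ {_} _ _.
Arguments csum_coproduct {_} _ {_} _.

Definition csum_map (C : category) (K : finite_coproducts C) n (A B : Fin.t n -> C)
    (f : forall i, hom (A i) (B i)) : hom (csum K A) (csum K B) :=
  copair (csum_coproduct K A) (fun i => cinj K B i ∘ f i).

Record smcat := SMCat {
  sm_cat :> category;
  unit_obj : sm_cat;
  tens : sm_cat -> sm_cat -> sm_cat;
  tens_map : forall X X' Y Y' : sm_cat,
    hom X X' -> hom Y Y' -> hom (tens X Y) (tens X' Y');
  tens_id : forall X Y, tens_map (idm X) (idm Y) = idm (tens X Y);
  tens_comp : forall X X' X'' Y Y' Y'' (f' : hom X' X'') (f : hom X X')
      (g' : hom Y' Y'') (g : hom Y Y'),
    tens_map (f' ∘ f) (g' ∘ g) = tens_map f' g' ∘ tens_map f g;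
  assoc : forall X Y Z, iso (tens (tens X Y) Z) (tens X (tens Y Z));
  lunit : forall X, iso (tens unit_obj X) X;
  runit : forall X, iso (tens X unit_obj) X;
  swap : forall X Y, hom (tens X Y) (tens Y X);
  assoc_nat : forall X X' Y Y' Z Z' (f : hom X X') (g : hom Y Y') (h : hom Z Z'),
    assoc X' Y' Z' ∘ tens_map (tens_map f g) h
    = tens_map f (tens_map g h) ∘ assoc X Y Z;
  lunit_nat : forall X X' (f : hom X X'),
    lunit X' ∘ tens_map (idm unit_obj) f = f ∘ lunit X;
  runit_nat : forall X X' (f : hom X X'),
    runit X' ∘ tens_map f (idm unit_obj) = f ∘ runit X;
  swap_nat : forall X X' Y Y' (f : hom X X') (g : hom Y Y'),
    swap X' Y' ∘ tens_map f g = tens_map g f ∘ swap X Y;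
  pentagon : forall W X Y Z,
    assoc W X (tens Y Z) ∘ assoc (tens W X) Y Z
    = tens_map (idm W) (assoc X Y Z) ∘ assoc W (tens X Y) Z
      ∘ tens_map (assoc W X Y) (idm Z);
  triangle : forall X Y,
    tens_map (idm X) (lunit Y) ∘ assoc X unit_obj Y
    = tens_map (runit X) (idm Y);
  hexagon : forall X Y Z,
    assoc Y Z X ∘ swap X (tens Y Z) ∘ assoc X Y Z
    = tens_map (idm Y) (swap X Z) ∘ assoc Y X Z ∘ tens_map (swap X Y) (idm Z);
  swapK : forall X Y, swap Y X ∘ swap X Y = idm (tens X Y) }.

Arguments unit_obj {_}.
Arguments tens {_} _ _.
Arguments tens_map {_ _ _ _ _} _ _.
Notation "X ⊗ Y" := (tens X Y) : cat_scope.
Notation "f ⊠ g" := (tens_map f g) : cat_scope.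

(* Bracketed to the right and ending in the unit: A_0 ⊗ (A_1 ⊗ (... ⊗ I)). *)
Fixpoint big_tens (C : smcat) (n : nat) : (Fin.t n -> C) -> C :=
  match n with
  | O => fun _ => unit_obj
  | S n => fun A => A Fin.F1 ⊗ big_tens (fun i => A (Fin.FS i))
  end.

Fixpoint big_tens_map (C : smcat) (n : nat) :
    forall A B : Fin.t n -> C, (forall i, hom (A i) (B i)) ->
    hom (big_tens A) (big_tens B) :=
  match n with
  | O => fun _ _ _ => idm unit_obj
  | S n => fun A B f => f Fin.F1 ⊠ big_tens_map (fun i => f (Fin.FS i))
  end.

Section Cospan.
Variables (C : smcat) (HI : is_initial (@unit_obj C)) (X Y : C).

Definition tens_inl : hom X (X ⊗ Y) :=
  (idm X ⊠ init_map HI Y) ∘ iso_bwd (runit X).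

Definition tens_inr : hom Y (X ⊗ Y) :=
  (init_map HI X ⊠ idm Y) ∘ iso_bwd (lunit Y).
End Cospan.

(* "The monoidal structure is given by finite coproducts".  This is data only up
   to the uniqueness of mediating maps: any two inhabitants have the same maps. *)
Record cocartesian (C : smcat) := Cocartesian {
  unit_initial : is_initial (@unit_obj C);
  tens_coproduct : forall X Y : C,
    is_binary_coproduct (tens_inl unit_initial X Y) (tens_inr unit_initial X Y) }.

Record sym_opmonoidal (C D : smcat) (F : functor C D) := SymOpmonoidal {
  op_unit : hom (F unit_obj) unit_obj;
  op_tens : forall X Y, hom (F (X ⊗ Y)) (F X ⊗ F Y);
  op_nat : forall X X' Y Y' (f : hom X X') (g : hom Y Y'),
    op_tens X' Y' ∘ fmap F (f ⊠ g) = (fmap F f ⊠ fmap F g) ∘ op_tens X Y;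
  op_assoc : forall X Y Z,
    assoc (F X) (F Y) (F Z) ∘ (op_tens X Y ⊠ idm (F Z)) ∘ op_tens (X ⊗ Y) Z
    = (idm (F X) ⊠ op_tens Y Z) ∘ op_tens X (Y ⊗ Z) ∘ fmap F (assoc X Y Z);
  op_lunit : forall X,
    lunit (F X) ∘ (op_unit ⊠ idm (F X)) ∘ op_tens unit_obj X = fmap F (lunit X);
  op_runit : forall X,
    runit (F X) ∘ (idm (F X) ⊠ op_unit) ∘ op_tens X unit_obj = fmap F (runit X);
  op_swap : forall X Y,
    swap (F X) (F Y) ∘ op_tens X Y = op_tens Y X ∘ fmap F (swap X Y) }.

Lemma comp_eq_pre (C : category) (W X Y Y' Z : C) (g : hom Y Z) (f : hom X Y)
    (g' : hom Y' Z) (f' : hom X Y') :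
  g ∘ f = g' ∘ f' -> forall h : hom W X, g ∘ (f ∘ h) = g' ∘ (f' ∘ h).
Proof. intros H h. now rewrite !comp_assoc, H. Qed.

Lemma tens_idl_comp (C : smcat) (W X Y Z : C) (g : hom Y Z) (f : hom X Y) :
  idm W ⊠ (g ∘ f) = (idm W ⊠ g) ∘ (idm W ⊠ f).
Proof. now rewrite <- tens_comp, comp_idl. Qed.

Lemma tens_idr_comp (C : smcat) (W X Y Z : C) (g : hom Y Z) (f : hom X Y) :
  (g ∘ f) ⊠ idm W = (g ⊠ idm W) ∘ (f ⊠ idm W).
Proof. now rewrite <- tens_comp, comp_idl. Qed.

Definition id_opmonoidal (C : smcat) : sym_opmonoidal (id_functor C).
Proof.
  refine (@SymOpmonoidal C C (id_functor C) (idm unit_obj)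
            (fun X Y => idm (X ⊗ Y)) _ _ _ _ _); simpl; intros;
  rewrite ?tens_id, ?comp_idl, ?comp_idr; reflexivity.
Defined.

Definition comp_opmonoidal (B C D : smcat) (G : functor C D) (F : functor B C)
    (g : sym_opmonoidal G) (f : sym_opmonoidal F) :
  sym_opmonoidal (comp_functor G F).
Proof.
  refine (@SymOpmonoidal B D (comp_functor G F)
            (op_unit g ∘ fmap G (op_unit f))
            (fun X Y => op_tens g (F X) (F Y) ∘ fmap G (op_tens f X Y))
            _ _ _ _ _); simpl; intros.
  - rewrite <- comp_assoc, <- fmap_comp, op_nat, fmap_comp, !comp_assoc, op_nat.
    reflexivity.
  - rewrite tens_idr_comp, tens_idl_comp, <- (fmap_id G (F Z)), <- (fmap_id G (F X)).
    rewrite <- !comp_assoc.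
    rewrite (comp_eq_pre (eq_sym (op_nat g (op_tens f X Y) (idm (F Z))))).
    rewrite (comp_eq_pre (eq_sym (op_nat g (idm (F X)) (op_tens f Y Z)))).
    rewrite <- !fmap_comp, !fmap_id.
    rewrite (comp_assoc (idm (F X) ⊠ op_tens f Y Z)), <- op_assoc.
    rewrite <- (comp_assoc (assoc _ _ _)), (fmap_comp G (assoc _ _ _)).
    rewrite (comp_assoc (op_tens g (F X) _)), (comp_assoc (idm _ ⊠ _)).
    rewrite (comp_assoc (idm _ ⊠ _)), <- op_assoc, <- !comp_assoc.
    reflexivity.
  - rewrite tens_idr_comp, <- (fmap_id G (F X)), <- !comp_assoc.
    rewrite (comp_eq_pre (eq_sym (op_nat g (op_unit f) (idm (F X))))).
    rewrite <- fmap_comp, fmap_id, !comp_assoc, op_lunit, <- fmap_comp.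
    now rewrite comp_assoc, op_lunit.
  - rewrite tens_idl_comp, <- (fmap_id G (F X)), <- !comp_assoc.
    rewrite (comp_eq_pre (eq_sym (op_nat g (idm (F X)) (op_unit f)))).
    rewrite <- fmap_comp, fmap_id, !comp_assoc, op_runit, <- fmap_comp.
    now rewrite comp_assoc, op_runit.
  - rewrite comp_assoc, op_swap, <- !comp_assoc, <- !fmap_comp.
    now rewrite op_swap.
Defined.

Record opmonoidal_trans (C D : smcat) (F G : functor C D)
    (f : sym_opmonoidal F) (g : sym_opmonoidal G) (a : nat_trans F G) : Prop :=
  OpmonoidalTrans {
  trans_unit : op_unit g ∘ a unit_obj = op_unit f;
  trans_tens : forall X Y, op_tens g X Y ∘ a (X ⊗ Y) = (a X ⊠ a Y) ∘ op_tens f X Y }.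

Record sym_opmonad (C : smcat) := SymOpmonad {
  opm_monad :> monad C;
  opm_str : sym_opmonoidal opm_monad;
  opm_eta : opmonoidal_trans (id_opmonoidal C) opm_str (eta opm_monad);
  opm_mu : opmonoidal_trans (comp_opmonoidal opm_str opm_str) opm_str (mu opm_monad) }.

Record is_algebra (C : category) (T : monad C) (X : C) (x : hom (T X) X) : Prop :=
  IsAlgebra {
  alg_eta : x ∘ eta T X = idm X;
  alg_mu : x ∘ mu T X = x ∘ fmap T x }.

Record algebra (C : category) (T : monad C) := Algebra {
  carrier : C;
  alg_str : hom (T carrier) carrier;
  alg_laws : is_algebra alg_str }.

Record alg_hom (C : category) (T : monad C) (X Y : algebra T) := AlgHom {
  alg_map : hom (carrier X) (carrier Y);
  alg_comm : alg_map ∘ alg_str X = alg_str Y ∘ fmap T alg_map }.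

Arguments alg_map {_ _ _ _} _.

Section EilenbergMoore.
Variables (C : category) (T : monad C).

Lemma alg_hom_eq (X Y : algebra T) (f g : alg_hom X Y) :
  alg_map f = alg_map g -> f = g.
Proof.
  destruct f as [f p], g as [g q]; simpl; intros E; subst g.
  now rewrite (proof_irrelevance _ p q).
Qed.

Lemma alg_id_comm (X : algebra T) :
  idm (carrier X) ∘ alg_str X = alg_str X ∘ fmap T (idm (carrier X)).
Proof. now rewrite fmap_id, comp_idl, comp_idr. Qed.

Lemma alg_comp_comm (X Y Z : algebra T) (g : alg_hom Y Z) (f : alg_hom X Y) :
  alg_map g ∘ alg_map f ∘ alg_str X = alg_str Z ∘ fmap T (alg_map g ∘ alg_map f).
Proof.
  now rewrite <- comp_assoc, alg_comm, comp_assoc, alg_comm, fmap_comp, comp_assoc.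
Qed.

Definition EM : category.
Proof.
  refine (@Category (algebra T) (@alg_hom C T)
            (fun X => AlgHom (alg_id_comm X))
            (fun X Y Z g f => AlgHom (alg_comp_comm g f)) _ _ _);
  intros; apply alg_hom_eq; simpl.
  - apply comp_idl.
  - apply comp_idr.
  - apply comp_assoc.
Defined.

Lemma alg_iso_comm (X Y : EM) (f : iso (carrier X) (carrier Y))
    (H : f ∘ alg_str X = alg_str Y ∘ fmap T f) :
  iso_bwd f ∘ alg_str Y = alg_str X ∘ fmap T (iso_bwd f).
Proof.
  rewrite <- (comp_idr (alg_str Y)), <- (fmap_id T), <- (iso_bwdK f), fmap_comp.
  rewrite (comp_assoc (alg_str Y)), <- H, !comp_assoc, iso_fwdK, comp_idl.
  reflexivity.
Qed.

Definition alg_iso (X Y : EM) (f : iso (carrier X) (carrier Y))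
    (H : f ∘ alg_str X = alg_str Y ∘ fmap T f) : iso X Y :=
  @Iso EM X Y (AlgHom H) (AlgHom (alg_iso_comm H))
    (@alg_hom_eq X X (AlgHom (alg_comp_comm (AlgHom (alg_iso_comm H)) (AlgHom H)))
       (AlgHom (alg_id_comm X)) (iso_fwdK f))
    (@alg_hom_eq Y Y (AlgHom (alg_comp_comm (AlgHom H) (AlgHom (alg_iso_comm H))))
       (AlgHom (alg_id_comm Y)) (iso_bwdK f)).

Lemma free_laws (A : C) : is_algebra (mu T A).
Proof. split; [apply mu_eta | apply mu_mu]. Qed.

Definition free (A : C) : EM := Algebra (free_laws A).

Lemma free_map_comm (A B : C) (f : hom A B) :
  fmap T f ∘ mu T A = mu T B ∘ fmap T (fmap T f).
Proof. symmetry. apply (nt_nat (mu T)). Qed.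

Definition free_map (A B : C) (f : hom A B) : hom (free A) (free B) :=
  @AlgHom C T (free A) (free B) (fmap T f) (free_map_comm f).

Section FreeCoproduct.
Variables (J : Type) (A : J -> C) (S : C) (inj : forall j, hom (A j) S).
Hypothesis P : is_coproduct inj.

Definition free_copair_map (Z : EM) (f : forall j, hom (free (A j)) Z) :
    hom (T S) (carrier Z) :=
  alg_str Z ∘ fmap T (copair P (fun j => alg_map (f j) ∘ eta T (A j))).

Lemma free_copair_comm (Z : EM) (f : forall j, hom (free (A j)) Z) :
  free_copair_map f ∘ mu T S = alg_str Z ∘ fmap T (free_copair_map f).
Proof.
  unfold free_copair_map.
  rewrite <- comp_assoc, free_map_comm, fmap_comp, !comp_assoc.
  now rewrite (alg_mu (alg_laws Z)).
Qed.

Definition free_coproduct : is_coproduct (fun j => free_map (inj j)).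
Proof.
  refine (@IsCoproduct EM J (fun j => free (A j)) (free S)
            (fun j => free_map (inj j))
            (fun Z f => @AlgHom C T (free S) Z _ (free_copair_comm f)) _ _).
  - intros Z f j. apply alg_hom_eq. simpl. unfold free_copair_map.
    rewrite <- comp_assoc, <- fmap_comp, copair_inj, fmap_comp, comp_assoc.
    rewrite <- (alg_comm (f j)), <- comp_assoc.
    etransitivity; [apply f_equal, mu_fmap_eta | apply comp_idr].
  - intros Z f h H. apply alg_hom_eq. simpl. unfold free_copair_map.
    rewrite <- (copair_uniq P (h := alg_map h ∘ eta T S)).
    + rewrite fmap_comp, comp_assoc, <- (alg_comm h), <- comp_assoc.
      symmetry. etransitivity; [apply f_equal, mu_fmap_eta | apply comp_idr].
    + intros j. rewrite <- H. simpl.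
      rewrite <- !comp_assoc. f_equal. apply (nt_nat (eta T)).
Defined.
End FreeCoproduct.
End EilenbergMoore.

Section Lift.
Variables (C : smcat) (T : sym_opmonad C).
Notation υI := (op_unit (opm_str T)).
Notation υ := (op_tens (opm_str T)).

Lemma unit_alg_laws : is_algebra (T := T) υI.
Proof.
  split.
  - apply (trans_unit (opm_eta T)).
  - apply (trans_unit (opm_mu T)).
Qed.

Definition unit_alg : EM T := Algebra unit_alg_laws.

Lemma tens_alg_laws (X Y : EM T) :
  is_algebra (T := T) ((alg_str X ⊠ alg_str Y) ∘ υ (carrier X) (carrier Y)).
Proof.
  split.
  - rewrite <- comp_assoc, (trans_tens (opm_eta T)). simpl.
    rewrite comp_idr, <- tens_comp.
    etransitivity; [apply f_equal2; apply alg_eta, alg_laws | apply tens_id].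
  - rewrite <- comp_assoc, (trans_tens (opm_mu T)). simpl.
    rewrite fmap_comp, <- comp_assoc, (comp_assoc (υ _ _) (fmap T (_ ⊠ _))), op_nat.
    rewrite !comp_assoc, <- !tens_comp.
    do 2 apply (f_equal (fun u => u ∘ _)).
    apply f_equal2; apply alg_mu, alg_laws.
Qed.

Definition tens_alg (X Y : EM T) : EM T := Algebra (tens_alg_laws X Y).

Lemma tens_alg_map_comm (X X' Y Y' : EM T) (f : hom X X') (g : hom Y Y') :
  (alg_map f ⊠ alg_map g) ∘ alg_str (tens_alg X Y)
  = alg_str (tens_alg X' Y') ∘ fmap T (alg_map f ⊠ alg_map g).
Proof.
  simpl. rewrite <- comp_assoc, op_nat, !comp_assoc, <- !tens_comp.
  now rewrite (alg_comm f), (alg_comm g).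
Qed.

Definition tens_alg_map (X X' Y Y' : EM T) (f : hom X X') (g : hom Y Y') :
    hom (tens_alg X Y) (tens_alg X' Y') :=
  @AlgHom C T (tens_alg X Y) (tens_alg X' Y') _ (tens_alg_map_comm f g).

Lemma assoc_alg_comm (X Y Z : EM T) :
  assoc (carrier X) (carrier Y) (carrier Z)
    ∘ alg_str (tens_alg (tens_alg X Y) Z)
  = alg_str (tens_alg X (tens_alg Y Z))
    ∘ fmap T (assoc (carrier X) (carrier Y) (carrier Z)).
Proof.
  simpl.
  rewrite <- (comp_idr (alg_str Z)) at 1. rewrite <- (comp_idr (alg_str X)) at 2.
  rewrite !tens_comp, !comp_assoc, assoc_nat, <- !comp_assoc. f_equal.
  rewrite !comp_assoc. apply op_assoc.
Qed.

Lemma lunit_alg_comm (X : EM T) :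
  lunit (carrier X) ∘ alg_str (tens_alg unit_alg X)
  = alg_str X ∘ fmap T (lunit (carrier X)).
Proof.
  simpl. rewrite <- (op_lunit (opm_str T)), !comp_assoc, <- lunit_nat.
  rewrite <- (comp_assoc (lunit _) (idm unit_obj ⊠ _)), <- tens_comp. now rewrite comp_idl, comp_idr.
Qed.

Lemma runit_alg_comm (X : EM T) :
  runit (carrier X) ∘ alg_str (tens_alg X unit_alg)
  = alg_str X ∘ fmap T (runit (carrier X)).
Proof.
  simpl. rewrite <- (op_runit (opm_str T)), !comp_assoc, <- runit_nat.
  rewrite <- (comp_assoc (runit _) (_ ⊠ idm unit_obj)), <- tens_comp. now rewrite comp_idl, comp_idr.
Qed.

Lemma swap_alg_comm (X Y : EM T) :
  swap (carrier X) (carrier Y) ∘ alg_str (tens_alg X Y)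
  = alg_str (tens_alg Y X) ∘ fmap T (swap (carrier X) (carrier Y)).
Proof.
  simpl. now rewrite comp_assoc, swap_nat, <- !comp_assoc, op_swap.
Qed.

Definition EM_sm : smcat.
Proof.
  refine (@SMCat (EM T) unit_alg tens_alg tens_alg_map _ _
    (fun X Y Z => alg_iso (X := tens_alg (tens_alg X Y) Z)
                    (Y := tens_alg X (tens_alg Y Z)) (assoc_alg_comm X Y Z))
    (fun X => alg_iso (X := tens_alg unit_alg X) (lunit_alg_comm X))
    (fun X => alg_iso (X := tens_alg X unit_alg) (runit_alg_comm X))
    (fun X Y => @AlgHom C T (tens_alg X Y) (tens_alg Y X) _ (swap_alg_comm X Y))
    _ _ _ _ _ _ _ _); intros; apply alg_hom_eq; simpl.
  - apply tens_id.
  - apply tens_comp.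
  - apply assoc_nat.
  - apply lunit_nat.
  - apply runit_nat.
  - apply swap_nat.
  - apply pentagon.
  - apply triangle.
  - apply hexagon.
  - apply swapK.
Defined.

Definition linear_exponential := cocartesian EM_sm.

(* The n-ary tensor of algebras.  It is the tensor [big_tens] of the symmetric
   monoidal category [EM_sm] (see [big_algE]), presented so that its carrier is,
   definitionally, the tensor in [C] of the carriers. *)
Fixpoint big_str (n : nat) : forall X : Fin.t n -> EM T,
    hom (T (big_tens (fun i => carrier (X i)))) (big_tens (fun i => carrier (X i))) :=
  match n with
  | O => fun _ => υI
  | S n => fun X =>
      (alg_str (X Fin.F1) ⊠ big_str (fun i => X (Fin.FS i))) ∘ υ _ _
  end.

Fixpoint big_alg_laws (n : nat) :
    forall X : Fin.t n -> EM T, is_algebra (big_str X) :=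
  match n with
  | O => fun _ => unit_alg_laws
  | S n => fun X =>
      tens_alg_laws (X Fin.F1) (Algebra (big_alg_laws (fun i => X (Fin.FS i))))
  end.

Definition big_alg (n : nat) (X : Fin.t n -> EM T) : EM T :=
  Algebra (big_alg_laws X).

Lemma big_algE (n : nat) (X : Fin.t n -> EM T) :
  big_alg X = big_tens (C := EM_sm) X.
Proof.
  induction n as [|n IH]; [reflexivity|].
  change (tens_alg (X Fin.F1) (big_alg (fun i => X (Fin.FS i)))
          = tens_alg (X Fin.F1) (big_tens (C := EM_sm) (fun i => X (Fin.FS i)))).
  now rewrite IH.
Qed.

Section BigCoproduct.
Hypothesis H : linear_exponential.

Fixpoint big_inj (n : nat) (i : Fin.t n) {struct i} :
    forall X : Fin.t n -> EM T, hom (X i) (big_alg X) :=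
  match i in Fin.t n return forall X : Fin.t n -> EM T, hom (X i) (big_alg X) with
  | @Fin.F1 n => fun X =>
      tens_inl (C := EM_sm) (unit_initial H)
        (X Fin.F1) (big_alg (fun i => X (Fin.FS i)))
  | @Fin.FS n j => fun X =>
      @comp (EM T) _ _ (big_alg X)
        (tens_inr (C := EM_sm) (unit_initial H)
           (X Fin.F1) (big_alg (fun i => X (Fin.FS i))))
        (big_inj j (fun i => X (Fin.FS i)))
  end.

Fixpoint big_copair (n : nat) : forall (X : Fin.t n -> EM T) (Z : EM T),
    (forall i, hom (X i) Z) -> hom (big_alg X) Z :=
  match n with
  | O => fun _ Z _ => init_map (unit_initial H) Z
  | S n => fun X Z f =>
      bcopair (tens_coproduct H (X Fin.F1) (big_alg (fun i => X (Fin.FS i))))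
        (f Fin.F1) (big_copair (fun i => f (Fin.FS i)))
  end.

Lemma big_copair_inj (n : nat) (i : Fin.t n) (X : Fin.t n -> EM T) (Z : EM T)
    (f : forall i, hom (X i) Z) :
  big_copair f ∘ big_inj i X = f i.
Proof.
  induction i as [n|n i IH].
  - apply (bcopair_l (tens_coproduct H (X Fin.F1) (big_alg (fun i => X (Fin.FS i))))).
  - pose (Y := big_alg (fun i => X (Fin.FS i))).
    change (@comp (EM T) _ (tens_alg (X Fin.F1) Y) Z
              (bcopair (tens_coproduct H (X Fin.F1) Y)
                 (f Fin.F1) (big_copair (fun i => f (Fin.FS i))))
              (@comp (EM T) _ Y _
                 (tens_inr (C := EM_sm) (unit_initial H) (X Fin.F1) Y)
                 (big_inj i (fun i => X (Fin.FS i))))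
            = f (Fin.FS i)).
    etransitivity; [apply (comp_assoc (c := EM T))|].
    rewrite (bcopair_r (tens_coproduct H (X Fin.F1) Y)).
    apply (IH (fun i => X (Fin.FS i)) (fun i => f (Fin.FS i))).
Qed.

Lemma big_copair_uniq (n : nat) (X : Fin.t n -> EM T) (Z : EM T)
    (f : forall i, hom (X i) Z) (h : hom (big_alg X) Z) :
  (forall i, h ∘ big_inj i X = f i) -> h = big_copair f.
Proof.
  induction n as [|n IH]; intros E.
  - apply (init_uniq (unit_initial H)).
  - apply (bcopair_uniq (tens_coproduct H (X Fin.F1) (big_alg (fun i => X (Fin.FS i))))).
    + exact (E Fin.F1).
    + apply (IH (fun i => X (Fin.FS i)) (fun i => f (Fin.FS i))).
      intros i. rewrite <- (E (Fin.FS i)). symmetry. apply (comp_assoc (c := EM T)).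
Qed.

Definition big_alg_coproduct (n : nat) (X : Fin.t n -> EM T) :
    is_coproduct (fun i => big_inj i X) :=
  @IsCoproduct (EM T) (Fin.t n) X (big_alg X) (fun i => big_inj i X)
    (@big_copair n X) (fun Z f i => big_copair_inj i f) (@big_copair_uniq n X).

Variable K : finite_coproducts C.

Definition phi (n : nat) (A : Fin.t n -> C) :
    iso (free T (csum K A)) (big_alg (fun i => free T (A i))) :=
  coproduct_iso (free_coproduct T (csum_coproduct K A))
                (big_alg_coproduct (fun i => free T (A i))).

Definition hypernorm (n : nat) (A : Fin.t n -> C) :
    hom (T (csum K A)) (T (csum K (fun i => T (A i)))) :=
  alg_map (iso_bwd (phi (fun i => T (A i))))
    ∘ big_tens_map (fun i => eta T (T (A i)))
    ∘ alg_map (iso_fwd (phi A)).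
End BigCoproduct.
End Lift.

Definition affine (C : category) (one : terminal C) (T : monad C) : Prop :=
  is_invertible (bang one (T one)).

(* Main.v *)
(* The map [phi] is natural in the family [A], so both sides become
   [phi⁻¹ ∘ (a big tensor of maps T (A i) -> T 1) ∘ phi]; the components agree
   because affineness makes [T 1] terminal. *)
Require Import Defs.

Set Implicit Arguments.
Unset Strict Implicit.
Unset Printing Implicit Defensive.

(** The canonical isomorphism φ compares two coproducts of free algebras, so it is natural in the
    family ([phi_nat]): a map of families acts on both sides compatibly with the injections
    ([big_inj_nat]). By naturality of φ⁻¹ ([phi_bwd_nat]), the left-hand side is φ⁻¹ ∘ ⊗(T! ∘ η) ∘
    φ. Each factor is a map T(A i) → T1, and T1 is terminal by affineness, so it equals T!
    ([affine_hom_eq]). Naturality once more, with φ⁻¹ ∘ φ = id, gives the right-hand side. *)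

Lemma runit_bwd_nat (C : smcat) (X X' : C) (f : hom X X') :
  (f ⊠ idm unit_obj) ∘ iso_bwd (runit X) = iso_bwd (runit X') ∘ f.
Proof.
  rewrite <- (comp_idl (_ ∘ iso_bwd (runit X))), <- (iso_fwdK (runit X')).
  rewrite <- comp_assoc, (comp_assoc (runit X')), runit_nat.
  now rewrite <- comp_assoc, iso_bwdK, comp_idr.
Qed.

Lemma lunit_bwd_nat (C : smcat) (X X' : C) (f : hom X X') :
  (idm unit_obj ⊠ f) ∘ iso_bwd (lunit X) = iso_bwd (lunit X') ∘ f.
Proof.
  rewrite <- (comp_idl (_ ∘ iso_bwd (lunit X))), <- (iso_fwdK (lunit X')).
  rewrite <- comp_assoc, (comp_assoc (lunit X')), lunit_nat.
  now rewrite <- comp_assoc, iso_bwdK, comp_idr.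
Qed.

(** Naturality of the unitor handles [f]; [g] is absorbed because [g ∘ !] is again the unique map
    out of the initial unit. *)
Lemma tens_inl_nat (C : smcat) (HI : is_initial (@unit_obj C)) (X X' Y Y' : C)
    (f : hom X X') (g : hom Y Y') :
  (f ⊠ g) ∘ tens_inl HI X Y = tens_inl HI X' Y' ∘ f.
Proof.
  unfold tens_inl.
  rewrite <- comp_assoc, <- runit_bwd_nat, !comp_assoc, <- !tens_comp.
  now rewrite comp_idl, !comp_idr, (init_uniq HI (g ∘ _)).
Qed.

Lemma tens_inr_nat (C : smcat) (HI : is_initial (@unit_obj C)) (X X' Y Y' : C)
    (f : hom X X') (g : hom Y Y') :
  (f ⊠ g) ∘ tens_inr HI X Y = tens_inr HI X' Y' ∘ g.
Proof.
  unfold tens_inr.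
  rewrite <- comp_assoc, <- lunit_bwd_nat, !comp_assoc, <- !tens_comp.
  now rewrite comp_idl, !comp_idr, (init_uniq HI (f ∘ _)).
Qed.

Lemma big_tens_map_comp (C : smcat) (n : nat) (A B D : Fin.t n -> C)
    (g : forall i, hom (B i) (D i)) (f : forall i, hom (A i) (B i)) :
  big_tens_map (fun i => g i ∘ f i) = big_tens_map g ∘ big_tens_map f.
Proof.
  induction n as [|n IH]; simpl.
  - now rewrite comp_idl.
  - now rewrite IH, tens_comp.
Qed.

Lemma big_tens_map_ext (C : smcat) (n : nat) (A B : Fin.t n -> C)
    (f g : forall i, hom (A i) (B i)) :
  (forall i, f i = g i) -> big_tens_map f = big_tens_map g.
Proof.
  intros E; induction n as [|n IH]; simpl; [reflexivity|].
  rewrite (E Fin.F1). f_equal. now apply IH.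
Qed.

Section BigAlgebraMap.
Variables (C : smcat) (T : sym_opmonad C).

Lemma big_alg_map_comm (n : nat) (X Y : Fin.t n -> EM T)
    (f : forall i, hom (X i) (Y i)) :
  big_tens_map (fun i => alg_map (f i)) ∘ alg_str (big_alg X)
  = alg_str (big_alg Y) ∘ fmap T (big_tens_map (fun i => alg_map (f i))).
Proof.
  induction n as [|n IH].
  - simpl. now rewrite fmap_id, comp_idl, comp_idr.
  - exact (tens_alg_map_comm (f Fin.F1)
             (AlgHom (X := big_alg (fun i => X (Fin.FS i)))
                (Y := big_alg (fun i => Y (Fin.FS i)))
                (IH _ _ (fun i => f (Fin.FS i))))).
Qed.

Definition big_alg_map (n : nat) (X Y : Fin.t n -> EM T)
    (f : forall i, hom (X i) (Y i)) : hom (big_alg X) (big_alg Y) :=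
  AlgHom (X := big_alg X) (Y := big_alg Y) (big_alg_map_comm f).

(** Exhibits the map as a binary tensor in [EM_sm], so that naturality of [tens_inl] and [tens_inr]
    applies. *)
Lemma big_alg_mapS (n : nat) (X Y : Fin.t (S n) -> EM T)
    (f : forall i, hom (X i) (Y i)) :
  big_alg_map f = tens_alg_map (f Fin.F1) (big_alg_map (fun i => f (Fin.FS i))).
Proof. now apply alg_hom_eq. Qed.

Variable H : linear_exponential T.

Lemma big_inj_nat (n : nat) (i : Fin.t n) (X Y : Fin.t n -> EM T)
    (f : forall i, hom (X i) (Y i)) :
  big_alg_map f ∘ big_inj H i X = big_inj H i Y ∘ f i.
Proof.
  induction i as [n|n i IH]; rewrite big_alg_mapS.
  - exact (tens_inl_nat (C := EM_sm T) (unit_initial H) (f Fin.F1)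
             (big_alg_map (fun i => f (Fin.FS i)))).
  - etransitivity; [apply (comp_assoc (c := EM T))|].
    etransitivity.
    { apply (f_equal (fun u => @comp (EM T) _ _ _ u _)).
      exact (tens_inr_nat (C := EM_sm T) (unit_initial H) (f Fin.F1)
               (big_alg_map (fun i => f (Fin.FS i)))). }
    etransitivity; [symmetry; apply (comp_assoc (c := EM T))|].
    etransitivity; [|apply (comp_assoc (c := EM T))].
    apply f_equal. apply (IH _ _ (fun i => f (Fin.FS i))).
Qed.

Variable K : finite_coproducts C.

Lemma phi_nat (n : nat) (A B : Fin.t n -> C) (f : forall i, hom (A i) (B i)) :
  phi H K B ∘ free_map T (csum_map K f)
  = big_alg_map (fun i => free_map T (f i)) ∘ phi H K A.
Proof.
  pose (P := free_coproduct T (csum_coproduct K A)).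
  pose (Q := free_coproduct T (csum_coproduct K B)).
  (* Both composites leave a coproduct of free algebras, and this is their common mediating map. *)
  transitivity (copair P (fun i => big_inj H i (fun i => free T (B i))
                                     ∘ free_map T (f i))).
  - apply copair_uniq. intros i.
    rewrite <- comp_assoc.
    assert (E : free_map T (csum_map K f) ∘ free_map T (cinj K A i)
                = free_map T (cinj K B i) ∘ free_map T (f i)).
    { apply alg_hom_eq. simpl. rewrite <- !fmap_comp. f_equal.
      apply (copair_inj (csum_coproduct K A)). }
    rewrite E, comp_assoc. f_equal.
    apply (copair_inj Q).
  - symmetry. apply copair_uniq. intros i.
    rewrite <- comp_assoc.
    etransitivity; [apply f_equal, (copair_inj P)|].
    apply (big_inj_nat i (fun i => free_map T (f i))).
Qed.

Lemma phi_bwd_nat (n : nat) (A B : Fin.t n -> C) (f : forall i, hom (A i) (B i)) :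
  free_map T (csum_map K f) ∘ iso_bwd (phi H K A)
  = iso_bwd (phi H K B) ∘ big_alg_map (fun i => free_map T (f i)).
Proof.
  rewrite <- (comp_idl (_ ∘ iso_bwd _)), <- (iso_fwdK (phi H K B)).
  rewrite <- comp_assoc, (comp_assoc (phi H K B)), phi_nat.
  now rewrite <- comp_assoc, iso_bwdK, comp_idr.
Qed.
End BigAlgebraMap.

(** The map T1 → 1 has a left inverse, so it can be cancelled after composing into the terminal
    object. *)
Lemma affine_hom_eq (C : category) (one : terminal C) (T : monad C) (X : C)
    (f g : hom X (T one)) :
  affine one T -> f = g.
Proof.
  intros [h [hK _]].
  rewrite <- (comp_idl f), <- (comp_idl g), <- hK, <- !comp_assoc.
  now rewrite (bang_uniq (bang _ _ ∘ f)), (bang_uniq (bang _ _ ∘ g)).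
Qed.

Theorem proposition17 (C : smcat) (K : finite_coproducts C) (one : terminal C)
    (T : sym_opmonad C) (H : linear_exponential T) (Haff : affine one T)
    (n : nat) (A : Fin.t n -> C) :
  fmap T (csum_map K (fun i => bang one (T (A i)))) ∘ hypernorm H K A
  = fmap T (csum_map K (fun i => bang one (A i))).
Proof.
  unfold hypernorm.
  (* The equations about φ live in [EM T], but the units in the middle of the hypernormalisation map
     need not be algebra morphisms, so everything is moved to underlying maps in [C]. *)
  pose proof (f_equal (@alg_map _ _ _ _)
    (phi_bwd_nat H K (fun i => bang one (T (A i))))) as E1.
  pose proof (f_equal (@alg_map _ _ _ _)
    (phi_bwd_nat H K (fun i => bang one (A i)))) as E2.
  pose proof (f_equal (@alg_map _ _ _ _) (iso_fwdK (phi H K A))) as E3.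
  simpl in E1, E2, E3 |- *.
  rewrite !comp_assoc, E1.
  rewrite <- (comp_assoc _ (big_tens_map _) (big_tens_map _)).
  rewrite <- big_tens_map_comp.
  (* Affineness enters here: [T(!) ∘ η] and [T(!)] are parallel maps into T1. *)
  rewrite (big_tens_map_ext (g := fun i => fmap T (bang one (A i)))).
  2: intros i; now apply (affine_hom_eq (one := one)).
  etransitivity; [apply (f_equal (fun u => u ∘ _)); symmetry; exact E2|].
  rewrite <- comp_assoc.
  etransitivity; [apply f_equal; exact E3|]. apply comp_idr.
Qed.
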